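(* Let $\mathcal{Q}=(Q,\&)$ be a quantale. The class $\mathcal{F}$ of flat ideals is saturated; that is, for every $\mathcal{Q}$-ordered set $A$ and every flat ideal $\Lambda$ of the $\mathcal{Q}$-ordered set $\mathcal{F}(A)$, the map $\bigvee_{\phi\in\mathcal{F}(A)}\Lambda(\phi)\&\phi : A\to Q$ is a flat ideal of $A$.
   Context: A quantale $\mathcal{Q}=(Q,\&)$ is always assumed integral and commutative: $Q$ is a complete lattice (bottom $0$, top $1$) and $\&$ is a commutative associative operation on $Q$ with unit $1$ that distributes over arbitrary joins. Its implication $\to$ is defined by $p\&q\le r\iff q\le p\to r$. A $\mathcal{Q}$-ordered set is a set $A$ with a map $A(-,-):A\times A\to Q$ such that $A(x,x)=1$ and $A(y,z)\&A(x,y)\le A(x,z)$ for all $x,y,z\in A$. A fuzzy lower set of $A$ is a map $\phi:A\to Q$ with $\phi(y)\&A(x,y)\le\phi(x)$ for all $x,y$; a fuzzy upper set is a map $\psi:A\to Q$ with $A(x,y)\&\psi(x)\le\psi(y)$ for all $x,y$. Joins and meets of maps $A\to Q$ are pointwise and $(p\&\phi)(x)=p\&\phi(x)$. For fuzzy lower sets, $\mathrm{sub}_A(\phi_1,\phi_2)=\bigwedge_{x\in A}(\phi_1(x)\to\phi_2(x))$. For a fuzzy lower set $\phi$ and a fuzzy upper set $\psi$, $\phi\otimes\psi=\bigvee_{x\in A}\phi(x)\&\psi(x)$. A map $\lambda:A\to Q$ is inhabited if $\bigvee_{a\in A}\lambda(a)=1$. A fuzzy lower set $\phi$ of $A$ is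 a flat ideal if it is inhabited and $\phi\otimes(\psi_1\wedge\psi_2)=(\phi\otimes\psi_1)\wedge(\phi\otimes\psi_2)$ for all fuzzy upper sets $\psi_1,\psi_2$ of $A$. $\mathcal{F}(A)$ denotes the set of flat ideals of $A$, made into a $\mathcal{Q}$-ordered set by $\mathrm{sub}_A$. In general, a class of weights $\Phi$ (assigning to each $A$ a set $\Phi(A)$ of fuzzy lower sets of $A$, $\mathcal{Q}$-ordered by $\mathrm{sub}_A$) is saturated if $\bigvee_{\phi\in\Phi(A)}\Lambda(\phi)\&\phi\in\Phi(A)$ for all $A$ and all $\Lambda\in\Phi(\Phi(A))$. *)

(* Defs.v *)
From HB Require Import structures.
From mathcomp Require Import all_boot all_order.
From mathcomp Require Import boolp classical_sets.

Set Implicit Arguments.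
Unset Strict Implicit.
Unset Printing Implicit Defensive.

Import Order.TTheory.

Declare Scope quantale_scope.
Delimit Scope quantale_scope with QS.
Local Open Scope order_scope.
Local Open Scope classical_set_scope.
Local Open Scope quantale_scope.

Reserved Notation "p ** q" (at level 40, left associativity).
Reserved Notation "p ~> q" (at level 55, right associativity).

(* Infima of arbitrary sets are derived from suprema: see [infimums_neq0]. *)
HB.mixin Record TBLattice_isComplete d (L : Type) of Order.TBLattice d L := {
  supremums_neq0 : forall S : set L, supremums S !=set0
}.

#[short(type="completeLatticeType")]
HB.structure Definition CompleteLattice (d : Order.disp_t) :=
  { L of TBLattice_isComplete d L & Order.TBLattice d L }.

(* The default values make the library's [supremum] and [infimum] correct on
   the empty set as well. *)
Definition Join d (L : completeLatticeType d) (S : set L) : L :=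
  supremum \bot S.
Definition Meet d (L : completeLatticeType d) (S : set L) : L :=
  infimum \top S.

Notation joins f := (Join (range f)).
Notation meets f := (Meet (range f)).

Section CompleteLatticeTheory.
Context {d : Order.disp_t} {L : completeLatticeType d}.
Implicit Types (S : set L) (x : L).

Lemma Join_ub S x : S x -> x <= Join S.
Proof.
rewrite /Join /supremum; case: ifPn => [/eqP -> //|_] Sx.
have [y Sy] := supremums_neq0 S.
by case: xgetP => [z _ [ub _]|/(_ y)//]; exact: ub.
Qed.

Lemma Join_le S x : ubound S x -> Join S <= x.
Proof.
move=> Sx; rewrite /Join /supremum; case: ifPn => _; first exact: le0x.
have [y Sy] := supremums_neq0 S.
by case: xgetP => [z _ [_ lb]|/(_ y)//]; exact: lb.
Qed.

Lemma infimums_neq0 S : infimums S !=set0.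
Proof.
exists (Join (lbound S)); split=> x Sx; last exact: Join_ub.
by apply: Join_le => y; apply.
Qed.

Lemma Meet_lb S x : S x -> Meet S <= x.
Proof.
rewrite /Meet /infimum; case: ifPn => [/eqP -> //|_] Sx.
have [y Sy] := infimums_neq0 S.
by case: xgetP => [z _ [lb _]|/(_ y)//]; exact: lb.
Qed.

Lemma Meet_ge S x : lbound S x -> x <= Meet S.
Proof.
move=> Sx; rewrite /Meet /infimum; case: ifPn => _; first exact: lex1.
have [y Sy] := infimums_neq0 S.
by case: xgetP => [z _ [_ ub]|/(_ y)//]; exact: ub.
Qed.

End CompleteLatticeTheory.

(* Commutative and integral: the unit of the multiplication is the top. *)
HB.mixin Record CompleteLattice_isQuantale d (Q : Type)
    of CompleteLattice d Q := {
  qmul : Q -> Q -> Q;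
  qmulA : associative qmul;
  qmulC : commutative qmul;
  qmul1q : left_id \top qmul;
  qmul_Join : forall (p : Q) (S : set Q), qmul p (Join S) = Join (qmul p @` S)
}.

#[short(type="quantaleType")]
HB.structure Definition Quantale (d : Order.disp_t) :=
  { Q of CompleteLattice_isQuantale d Q & CompleteLattice d Q }.

Notation "p ** q" := (qmul p q) : quantale_scope.

Definition qimp d (Q : quantaleType d) (p r : Q) : Q :=
  Join [set q | p ** q <= r].

Notation "p ~> r" := (qimp p r) : quantale_scope.

Section QuantaleTheory.
Context {d : Order.disp_t} {Q : quantaleType d}.
Implicit Types p q r : Q.

Lemma qmul_le p q r : q <= r -> p ** q <= p ** r.
Proof.
move=> qr; have eqr : Join [set q; r] = r.
  apply/eqP; rewrite eq_le Join_ub ?Join_le//; last by right.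
  by move=> x [->|->].
by rewrite -[r in leRHS]eqr qmul_Join; apply: Join_ub; exists q => //; left.
Qed.

Lemma qimpP p q r : (p ** q <= r) = (q <= p ~> r).
Proof.
apply/idP/idP => [pq|qr]; first exact: Join_ub.
apply: le_trans (qmul_le _ qr) _; rewrite qmul_Join.
by apply: Join_le => _ [x px <-].
Qed.

Lemma qmul_imp p r : p ** (p ~> r) <= r.
Proof. by rewrite qimpP. Qed.

End QuantaleTheory.

Record qOrderedSet d (Q : quantaleType d) := QOrderedSet {
  qcarrier :> Type;
  qhom : qcarrier -> qcarrier -> Q;
  qhom_refl : forall x, qhom x x = \top;
  qhom_trans : forall x y z, qhom y z ** qhom x y <= qhom x z
}.

Section Fuzzy.
Context {d : Order.disp_t} {Q : quantaleType d}.
Implicit Types A : qOrderedSet Q.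

Definition fuzzy_lower A (phi : A -> Q) : Prop :=
  forall x y, phi y ** qhom x y <= phi x.

Definition fuzzy_upper A (psi : A -> Q) : Prop :=
  forall x y, qhom x y ** psi x <= psi y.

Definition sub A (phi1 phi2 : A -> Q) : Q :=
  meets (fun x => phi1 x ~> phi2 x).

Definition tensor A (phi psi : A -> Q) : Q :=
  joins (fun x => phi x ** psi x).

Definition inhabited_map A (lambda : A -> Q) : Prop :=
  joins lambda = \top.

Definition flat_ideal A (phi : A -> Q) : Prop :=
  [/\ fuzzy_lower phi, inhabited_map phi &
    forall psi1 psi2 : A -> Q, fuzzy_upper psi1 -> fuzzy_upper psi2 ->
      tensor phi (fun x => psi1 x `&` psi2 x)%O =
      (tensor phi psi1 `&` tensor phi psi2)%O].

Lemma sub_refl A (phi : A -> Q) : sub phi phi = \top.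
Proof.
apply/eqP; rewrite -le1x; apply: Meet_ge => _ [x _ <-].
by rewrite -qimpP qmulC qmul1q.
Qed.

Lemma sub_trans A (phi1 phi2 phi3 : A -> Q) :
  sub phi2 phi3 ** sub phi1 phi2 <= sub phi1 phi3.
Proof.
apply: Meet_ge => _ [x _ <-].
have sub_le (f g : A -> Q) : f x ** sub f g <= g x.
  by rewrite qimpP; apply: Meet_lb; exists x.
rewrite -qimpP [sub phi2 _ ** _]qmulC qmulA.
apply: le_trans (sub_le phi2 phi3).
by rewrite ![_ ** sub phi2 phi3]qmulC; exact: qmul_le.
Qed.

End Fuzzy.

Record weightClass d (Q : quantaleType d) := WeightClass {
  weights :> forall A : qOrderedSet Q, set (A -> Q);
  weights_lower : forall A phi, @weights A phi -> fuzzy_lower phi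
}.

Section Saturation.
Context {d : Order.disp_t} {Q : quantaleType d}.

Definition weightSet (Phi : weightClass Q) (A : qOrderedSet Q) :
    qOrderedSet Q :=
  @QOrderedSet d Q {phi : A -> Q | Phi A phi}
    (fun phi1 phi2 => sub (sval phi1) (sval phi2))
    (fun phi => sub_refl (sval phi))
    (fun phi1 phi2 phi3 => sub_trans (sval phi1) (sval phi2) (sval phi3)).

Definition saturated (Phi : weightClass Q) : Prop :=
  forall (A : qOrderedSet Q) (Lambda : weightSet Phi A -> Q),
    Phi (weightSet Phi A) Lambda ->
    Phi A (fun x => joins (fun phi : weightSet Phi A =>
                             Lambda phi ** sval phi x)).

End Saturation.

Definition flatIdeals d (Q : quantaleType d) : weightClass Q :=
  @WeightClass d Q (fun A phi => flat_ideal phi)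
    (fun A phi flat_phi => let: And3 lower_phi _ _ := flat_phi in lower_phi).

(* Main.v *)
Require Import Defs.
From mathcomp Require Import all_boot all_order.
From mathcomp Require Import boolp classical_sets.

(** For a fuzzy upper set [psi] of [A], the map [phi |-> tensor phi psi] is a
fuzzy upper set of the flat ideals of [A].  Interchanging two joins, tensoring
the union of a weight [Lambda] with [psi] is tensoring [Lambda] with that map
([tensor_union]): this is associativity of the tensor.  Each flat ideal [phi]
preserves binary meets in the argument [psi], so the assignment of
[phi |-> tensor phi psi] to [psi] preserves them; tensoring with the flat ideal
[Lambda] preserves them again, hence so does tensoring with the union.

Inhabitedness follows in the same way from the nullary meet: a map is
inhabited exactly when its tensor with the constant map [\top] is [\top]. *)

Set Implicit Arguments.
Unset Strict Implicit.
Unset Printing Implicit Defensive.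

Import Order.TTheory.
Local Open Scope order_scope.
Local Open Scope classical_set_scope.
Local Open Scope quantale_scope.

Section FamilyJoins.
Context {d : Order.disp_t} {Q : quantaleType d}.
Implicit Types p q r : Q.

Lemma joins_ub (T : Type) (f : T -> Q) t : f t <= joins f.
Proof. by apply: Join_ub; exists t. Qed.

Lemma joins_le (T : Type) (f : T -> Q) q :
  (forall t, f t <= q) -> joins f <= q.
Proof. by move=> fq; apply: Join_le => _ [t _ <-]. Qed.

Lemma eq_joins (T : Type) (f g : T -> Q) : f =1 g -> joins f = joins g.
Proof. by move=> /funext ->. Qed.

Lemma qmul_joins (T : Type) p (f : T -> Q) :
  p ** joins f = joins (fun t => p ** f t).
Proof. by rewrite qmul_Join image_comp. Qed.

Lemma joins_qmul (T : Type) (f : T -> Q) p :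
  joins f ** p = joins (fun t => f t ** p).
Proof. by rewrite qmulC qmul_joins; under eq_fun do rewrite qmulC. Qed.

Lemma exchange_joins (S T : Type) (f : S -> T -> Q) :
  joins (fun s => joins (f s)) = joins (fun t => joins (f^~ t)).
Proof.
apply/eqP; rewrite eq_le; apply/andP; split.
  apply: joins_le => s; apply: joins_le => t.
  exact: le_trans (joins_ub (f^~ t) s) (joins_ub (fun t => joins (f^~ t)) t).
apply: joins_le => t; apply: joins_le => s.
exact: le_trans (joins_ub (f s) t) (joins_ub (fun s => joins (f s)) s).
Qed.

Lemma qmul_ler p q r : q <= r -> q ** p <= r ** p.
Proof. by rewrite ![_ ** p]qmulC; exact: qmul_le. Qed.

Lemma qmulq1 p : p ** \top = p.
Proof. by rewrite qmulC qmul1q. Qed.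

End FamilyJoins.

Section Union.
Context {d : Order.disp_t} {Q : quantaleType d}.
Implicit Types A : qOrderedSet Q.

Lemma tensor_top A (phi : A -> Q) : tensor phi (fun=> \top) = joins phi.
Proof. by rewrite /tensor; under eq_fun do rewrite qmulq1. Qed.

Lemma sub_eval A (phi1 phi2 : A -> Q) x : sub phi1 phi2 ** phi1 x <= phi2 x.
Proof. by rewrite qmulC qimpP; apply: Meet_lb; exists x. Qed.

Lemma sub_tensor A (phi1 phi2 psi : A -> Q) :
  sub phi1 phi2 ** tensor phi1 psi <= tensor phi2 psi.
Proof.
rewrite qmul_joins; apply: joins_le => x; rewrite qmulA.
exact: le_trans (qmul_ler _ (sub_eval _ _ x)) (joins_ub _ x).
Qed.

Context {Phi : weightClass Q} {A : qOrderedSet Q}.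
Implicit Type Lambda : weightSet Phi A -> Q.

Definition weight_union Lambda (x : A) : Q :=
  joins (fun phi : weightSet Phi A => Lambda phi ** sval phi x).

(** As [psi] varies, this carries fuzzy upper sets of [A] to fuzzy upper sets of
the weights, against which the flatness of [Lambda] can be tested. *)
Definition tensor_with (psi : A -> Q) (phi : weightSet Phi A) : Q :=
  tensor (sval phi) psi.

Lemma tensor_with_upper (psi : A -> Q) : fuzzy_upper (tensor_with psi).
Proof. by move=> phi1 phi2; exact: sub_tensor. Qed.

(** Associativity of the tensor: both sides are the join over [phi] and [x] of
[Lambda phi ** phi x ** psi x]. *)
Lemma tensor_union Lambda (psi : A -> Q) :
  tensor (weight_union Lambda) psi = tensor Lambda (tensor_with psi).
Proof.
rewrite /tensor /weight_union; under eq_fun do rewrite joins_qmul.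
rewrite exchange_joins; apply: eq_joins => phi.
by rewrite qmul_joins; apply: eq_joins => x; rewrite qmulA.
Qed.

Lemma weight_union_lower Lambda : fuzzy_lower (weight_union Lambda).
Proof.
move=> x y; rewrite joins_qmul; apply: joins_le => phi; rewrite -qmulA.
apply: (@le_trans _ _ (Lambda phi ** sval phi x)).
  by apply: qmul_le; exact: weights_lower (svalP phi) x y.
exact: (joins_ub (fun phi : weightSet Phi A => Lambda phi ** sval phi x)).
Qed.

End Union.

Theorem proposition4p5 (d : Order.disp_t) (Q : quantaleType d) :
  saturated (flatIdeals Q).
Proof.
move=> A Lambda [_ Lambda1 LambdaI].
have tensor1 : tensor_with (fun=> \top) =
    (fun _ : weightSet (flatIdeals Q) A => \top : Q).
  apply/funext => -[phi [? phi1 ?]]; exact: etrans (tensor_top phi) phi1.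
have tensorI (psi1 psi2 : A -> Q) : fuzzy_upper psi1 -> fuzzy_upper psi2 ->
    tensor_with (fun x => psi1 x `&` psi2 x)%O =
    (fun phi : weightSet (flatIdeals Q) A =>
       tensor_with psi1 phi `&` tensor_with psi2 phi)%O.
  move=> up1 up2; apply/funext => -[phi [? ? phiI]]; exact: phiI.
split; first exact: weight_union_lower.
  rewrite /inhabited_map -tensor_top (tensor_union Lambda) tensor1.
  by rewrite tensor_top.
move=> psi1 psi2 up1 up2; rewrite !(tensor_union Lambda) tensorI//.
by apply: LambdaI; exact: tensor_with_upper.
Qed.
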